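(* Let $(\mathcal{P}_t)_{t\in T}$ be Markov transition kernels with invariant measure $\Pi$. Assume $\int_{\mathbf{X}}d(x,x_0)^{2p}\,\Pi(dx)<\infty$ for some $p>1$ and some $x_0\in\mathbf{X}$. Then for a rate function $R:T\to(0,1]$ strictly decreasing to $0$, the following are equivalent: (1) There are constants $C_1>0$ and $\kappa_1\in(0,1]$ such that for all $t\in T$, $$\Big\|\mathcal{P}_tf-\int_{\mathbf{X}}f\,d\Pi\Big\|_{L_1(\Pi)}\le C_1R(t)^{\kappa_1}\big(\|f\|_\infty+\|f\|_{\mathrm{Lip}(d)}\big)$$ holds for all bounded Lipschitz functions $f:\mathbf{X}\to\mathbb{R}$. (2) There are constants $C_2>0$ and $\kappa_2\in(0,1]$ such that for all $t\in T$, $$\Big\|\mathcal{P}_tf-\int_{\mathbf{X}}f\,d\Pi\Big\|_{L_2(\Pi)}^2\le C_2R(t)^{\kappa_2}\|f\|_{\mathrm{Lip}(d)}^2$$ holds for all Lipschitz functions $f:\mathbf{X}\to\mathbb{R}$.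
   Context: $\mathbf{X}$ is a nonempty metric space with metric $d$; all sets, functions and measures are Borel. $T$ is either $[0,\infty)$ or $\mathbb{Z}_+=\{0,1,2,\dots\}$. The kernels $\mathcal{P}_t(x,\cdot)=\mathbb{P}(X_t\in\cdot\mid X_0=x)$ are the transition kernels of a (time-homogeneous) Markov process $(X_t)_{t\in T}$ on $\mathbf{X}$ and form a Markov semigroup on $L_2(\Pi)$; $\Pi$ is the unique invariant probability measure, i.e. $\Pi\mathcal{P}_t=\Pi$ for all $t\in T$. Write $\mathcal{P}_tf(x)=\int f(y)\,\mathcal{P}_t(x,dy)$, $\|f\|_\infty=\sup_x|f(x)|$ and $\|f\|_{\mathrm{Lip}(d)}=\sup_{x\ne y}|f(y)-f(x)|/d(x,y)$. *)

(* Defs.v *)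
From HB Require Import structures.
From mathcomp Require Import all_boot all_order all_algebra.
From mathcomp Require Import all_classical all_reals all_analysis.

Set Implicit Arguments.
Unset Strict Implicit.
Unset Printing Implicit Defensive.

Import Order.TTheory GRing.Theory Num.Theory.
Import numFieldNormedType.Exports.

Local Open Scope classical_set_scope.
Local Open Scope ring_scope.

(* Nonempty metric spaces. *)
#[short(type="pmetricType")]
HB.structure Definition PointedMetric (K : numDomainType) :=
  { M of Metric K M & isPointed M }.

(* The metric space X with its Borel sigma-algebra; as a type it is
   convertible to X, so functions on X can be integrated directly. *)
Notation borel X := (g_sigma_algebraType (@open X)).

(* Time is either [0, +oo[ or {0, 1, 2, ...}, seen as a subset of R; functions
   of time are total on R, but only their values on T are ever used. *)
Definition time_set (R : realType) (T : set R) : Prop :=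
  T = [set t : R | 0 <= t] \/ T = range (fun n : nat => n%:R).

Section Semigroups.
Context (R : realType) (X : pmetricType R) (T : set R).
Implicit Type P : R -> R.-pker (borel X) ~> (borel X).

(* The kernels P(X_t \in . | X_0 = x) of a time-homogeneous Markov process:
   P_0(x, .) is the Dirac mass at x, and Chapman-Kolmogorov holds. *)
Definition markov_semigroup P : Prop :=
  (forall (x : borel X) (A : set (borel X)), measurable A ->
     P 0 x A = \d_x A) /\
  (forall s t : R, T s -> T t ->
   forall (x : borel X) (A : set (borel X)), measurable A ->
     P (s + t) x A = (\int[P s x]_y P t y A)%E).

Definition invariant P (Pi : probability (borel X) R) : Prop :=
  forall t : R, T t -> forall A : set (borel X), measurable A ->
    (\int[Pi]_x P t x A)%E = Pi A.

Definition unique_invariant P (Pi : probability (borel X) R) : Prop :=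
  invariant P Pi /\
  forall Q : probability (borel X) R, invariant P Q ->
    forall A : set (borel X), measurable A -> Q A = Pi A.

End Semigroups.

(* Real-valued integral: if f is integrable against Pi and Pi is invariant under
   k, then f is integrable against k x for Pi-almost every x. *)
Definition kernel_act (R : realType) (X : pmetricType R)
    (k : R.-pker (borel X) ~> (borel X)) (f : X -> R) (x : X) : R :=
  \int[k x]_y f y.

Section FunctionNorms.
Context (R : realType) (X : pmetricType R).
Implicit Type f : X -> R.

Definition is_lipschitz f : Prop :=
  exists K : R, forall x y : X, `|f y - f x| <= K * mdist x y.

(* The suprema below are taken in R, hence meaningful when f is bounded,
   respectively Lipschitz.  On a one-point space lip_seminorm f is
   sup set0 = 0, as it should be. *)
Definition sup_norm f : R := sup [set `|f x| | x in [set: X]].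

Definition lip_seminorm f : R :=
  sup [set `|f xy.2 - f xy.1| / mdist xy.1 xy.2
      | xy in [set xy : X * X | xy.1 <> xy.2]].

End FunctionNorms.

Definition rate_function (R : realType) (T : set R) (rate : R -> R) : Prop :=
  [/\ forall t, T t -> 0 < rate t <= 1,
      forall s t, T s -> T t -> s < t -> rate t < rate s
    & rate @ within T (pinfty_nbhs R) --> (0 : R)].

(* Main.v *)
Require Import Defs.
From mathcomp Require Import all_boot all_order all_algebra.
From mathcomp Require Import all_classical all_reals all_analysis.
From mathcomp Require Import measurable_realfun ring lra.

(* (2) implies (1) by Cauchy-Schwarz, with kappa1 = kappa2 / 2.  For the
   converse, truncate f - f(x0) at height L M, where L is the Lipschitz constant
   of f: the truncation u is bounded by L M and L-Lipschitz, so the square of its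
   deviation is controlled by 2 L M times its L1 deviation, hence by (1), while
   the remainder has second moment at most L^2 M^(2 - 2p) \int d(x, x0)^(2p) and
   P_t contracts L2 by Jensen's inequality and invariance.  The choice
   M = R(t)^(- kappa1 / (2p)) balances both terms and gives
   kappa2 = kappa1 (1 - 1/p). *)

Set Implicit Arguments.
Unset Strict Implicit.
Unset Printing Implicit Defensive.

Import Order.TTheory GRing.Theory Num.Theory.
Import numFieldNormedType.Exports.

Local Open Scope classical_set_scope.
Local Open Scope ring_scope.

(** * Integrals and Lebesgue norms under a measure of total mass one *)

Section MassOne.
Context d (T : measurableType d) (R : realType) (mu : {measure set T -> \bar R})
  (mu1 : mu [set: T] = 1%E).
Implicit Types g : T -> R.

Lemma integrable_mass1_bounded g (B : R) : measurable_fun [set: T] g ->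
  (forall x, `|g x| <= B) -> mu.-integrable [set: T] (EFin \o g).
Proof.
move=> mg gB; apply: measurable_bounded_integrable => //.
  by rewrite mu1 ltry.
exists B; split; first exact: num_real.
by move=> M BM x _ /=; rewrite (le_trans (gB x))// ltW.
Qed.

Lemma integrable_mass1_cst (c : R) : mu.-integrable [set: T] (fun=> c%:E).
Proof. exact: (@integrable_mass1_bounded (cst c) `|c|). Qed.

Lemma Rintegral_mass1_cst (c : R) : \int[mu]_x c = c.
Proof. by rewrite Rintegral_cst// mu1 mulr1. Qed.

(** Domination of [|g|] by [1 + g ^+ 2], whose first term is integrable because the total mass is
    one. *)
Lemma integrable_of_sqr g : measurable_fun [set: T] g ->
  mu.-integrable [set: T] (fun x => (g x ^+ 2)%:E) ->
  mu.-integrable [set: T] (EFin \o g).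
Proof.
move=> mg ig2.
apply: (le_integrable measurableT _ _
  (integrableD measurableT (integrable_mass1_cst 1) ig2)).
  exact/measurable_EFinP.
move=> x _; rewrite [leRHS]/= -?EFinD /= ?lee_fin.
rewrite [leRHS]ger0_norm ?addr_ge0 ?sqr_ge0//.
rewrite -real_normK ?num_real//; nra.
Qed.

(** Jensen's inequality for the square: with [c] the mean of [g], integrate the tangent-line bound
    [2 * c * g x - c ^+ 2 <= g x ^+ 2], whose left side has integral [c ^+ 2]. *)
Lemma sqr_Rintegral_le g : measurable_fun [set: T] g ->
  mu.-integrable [set: T] (fun x => (g x ^+ 2)%:E) ->
  (\int[mu]_x g x) ^+ 2 <= \int[mu]_x (g x ^+ 2).
Proof.
move=> mg ig2; have ig := integrable_of_sqr mg ig2.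
set c := Rintegral _ _ _.
have i2 : mu.-integrable [set: T] (fun x => (2 * c * g x)%:E).
  exact: (integrableZl measurableT (2 * c) ig).
have -> : c ^+ 2 = \int[mu]_x (2 * c * g x - c ^+ 2).
  rewrite (RintegralB measurableT i2 (integrable_mass1_cst _)).
  by rewrite RintegralZl// Rintegral_mass1_cst -/c; ring.
apply: le_Rintegral => //.
  exact: (integrableB measurableT i2 (integrable_mass1_cst _)).
by move=> x _; have := sqr_ge0 (g x - c); nra.
Qed.

(** Cauchy-Schwarz against the constant function 1, whose L2 norm is 1. *)
Lemma Lnorm1_le_sqrt (F : T -> R) (c : R) : measurable_fun [set: T] F ->
  ('N[mu]_2 [EFin \o F] ^+ 2 <= c%:E)%E ->
  ('N[mu]_1 [EFin \o F] <= (Num.sqrt c)%:E)%E.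
Proof.
move=> mF N2c; have mc : measurable_fun [set: T] (cst (1 : R)) by [].
have := hoelder mu mF mc (ltr0n R 2) (ltr0n R 2).
have -> : EFin \o (F \* cst 1) = EFin \o F.
  by apply/funext => x /=; rewrite mulr1.
rewrite [X in (_ * X)%E]Lnorm_cst1 mu1 poweR1r mule1.
have /[swap]/[apply] : (2^-1 + 2^-1 = 1 :> R) by lra.
move=> /le_trans; apply.
move: N2c; have := @Lnorm_ge0 _ _ _ mu 2%:E (EFin \o F).
case: Lnorm => [n| |//].
  rewrite -EFin_expe !lee_fin => n0 nc.
  by rewrite -(ger0_norm n0) -sqrtr_sqr ler_wsqrtr.
(* An infinite L2 norm would have an infinite square, against the bound [c]. *)
by rewrite expe2 mulyy.
Qed.

(** The general identity for powers of [Lnorm] uses a real exponent; real and natural squares agree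
    on nonnegative reals and at infinity. *)
Lemma sqr_Lnorm2 (F : T -> R) :
  ('N[mu]_2 [EFin \o F] ^+ 2 = \int[mu]_x (F x ^+ 2)%:E)%E.
Proof.
have := @poweR_Lnorm _ _ _ mu (EFin \o F) 2 (lt0r_neq0 (ltr0n R 2)).
under eq_integral do rewrite [(_ `^ _)%E]/= powR_mulrn// real_normK ?num_real//.
move<-; have := @Lnorm_ge0 _ _ _ mu 2%:E (EFin \o F).
case: Lnorm => [n| |//].
  by rewrite lee_fin => n0; rewrite poweR_EFin powR_mulrn// EFin_expe.
by rewrite poweRyr// expe2 mulyy.
Qed.

End MassOne.

(** * Integration along a probability kernel that preserves [mu] *)

Section InvariantKernel.
Context d (T : measurableType d) (R : realType) (mu : probability T R)
  (k : R.-pker T ~> T).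

(** The integrals of the positive and negative parts depend measurably on [x], and [fine], which
    sends infinite values to 0, is measurable. *)
Lemma measurable_Rintegral_kernel (f : T -> R) : measurable_fun [set: T] f ->
  measurable_fun [set: T] (fun x => \int[k x]_y f y).
Proof.
move=> mf; apply: measurableT_comp; first exact: fine_measurable.
under eq_fun do rewrite integralE.
by apply: emeasurable_funB; apply: measurable_fun_integral_kernel => //;
  do ?[exact: measurable_kernel | apply: measurable_funepos
      | apply: measurable_funeneg | exact/measurable_EFinP].
Qed.

Import HBNNSimple.

(** Invariance gives the identity on indicators, linearity extends it to simple functions, and
    monotone convergence under [mu] and under each [k x] passes to the limit. *)
Lemma integral_invariant_kernel (h : T -> \bar R) :
  (forall A, measurable A -> (\int[mu]_x k x A = mu A)%E) ->
  measurable_fun [set: T] h -> (forall x, 0 <= h x)%E ->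
  (\int[mu]_x \int[k x]_y h y = \int[mu]_x h x)%E.
Proof.
move=> kmu mh h0.
pose g := nnsfun_approx measurableT mh.
pose gE := fun n => EFin \o g n.
have mgE n : measurable_fun [set: T] (gE n) by exact/measurable_EFinP.
have gE_ge0 n x : (0 <= gE n x)%E by rewrite lee_fin.
have nd_gE x : {homo gE ^~ x : n m / (n <= m)%N >-> (n <= m)%E}.
  by move=> *; exact/lefP/nd_nnsfun_approx.
have gEh (nu : {measure set T -> \bar R}) :
    (\int[nu]_x h x = limn (fun n => \int[nu]_x gE n x))%E.
  rewrite -monotone_convergence//; apply: eq_integral => t _.
  by apply/esym/cvg_lim => //; exact: cvg_nnsfun_approx.
have mk n : measurable_fun [set: T] (fun x => \int[k x]_y gE n y)%E.
  by apply: measurable_fun_integral_kernel => //; exact: measurable_kernel.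
under eq_integral do rewrite gEh.
rewrite gEh monotone_convergence//; last 2 first.
  by move=> n x _; exact: integral_ge0.
  by move=> x _ m n mn; apply: ge0_le_integral => // t _; exact: nd_gE.
apply: congr_lim; apply/funext => n.
under eq_integral do rewrite integralT_nnsfun sintegralE.
rewrite integralT_nnsfun sintegralE ge0_integral_fsum//; last 2 first.
  by move=> r; apply: measurable_funeM; exact: measurable_kernel.
  by move=> r x _; exact: nnsfun_mulemu_ge0.
apply: eq_fsbigr => r _.
have [r0|r0] := leP 0 r.
  rewrite ge0_integralZl//; last exact: measurable_kernel.
  by rewrite kmu.
(* A nonnegative simple function takes no negative value [r], so both terms vanish. *)
rewrite preimage_nnfun0// measure0 mule0.
by under eq_integral do rewrite measure0 mule0; rewrite integral0.
Qed.

(** By invariance, [x |-> \int[k x]_y |h y|] has the same finite [mu]-integral as [|h|], so it is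
    finite almost everywhere. *)
Lemma integrable_invariant_kernel_ae (h : T -> R) :
  (forall A, measurable A -> (\int[mu]_x k x A = mu A)%E) ->
  mu.-integrable [set: T] (EFin \o h) ->
  {ae mu, forall x, (k x).-integrable [set: T] (EFin \o h)}.
Proof.
move=> kmu ih; have mh := measurable_int _ ih.
have mah : measurable_fun [set: T] (fun x => `|(h x)%:E|)%E.
  exact: measurableT_comp.
have : mu.-integrable [set: T] (fun x => \int[k x]_y `|(h y)%:E|)%E.
  apply/integrableP; split.
    by apply: measurable_fun_integral_kernel => //; exact: measurable_kernel.
  under eq_integral do rewrite gee0_abs ?integral_ge0//.
  by rewrite integral_invariant_kernel//; case/integrableP: ih.
move=> /(integrable_ae measurableT); apply: filterS => x /(_ I) kx.
by apply/integrableP; split => //; rewrite ltey_eq kx.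
Qed.

(** The constant [c] cancels in the deviation, and the square of a sum is at most twice the sum of
    squares. The deviation of [u] is at most [2 * B], so its square is at most [2 * B] times its
    absolute value. For [g], Jensen bounds both squared means by second moments, which integrate to
    the same value by invariance. *)
Lemma L2_deviation_split (c B : R) (f u g : T -> R) :
  (forall A, measurable A -> (\int[mu]_x k x A = mu A)%E) ->
  measurable_fun [set: T] u -> (forall x, `|u x| <= B) ->
  measurable_fun [set: T] g ->
  mu.-integrable [set: T] (fun x => (g x ^+ 2)%:E) ->
  (forall x, f x = c + u x + g x) ->
  (\int[mu]_x ((\int[k x]_y f y - \int[mu]_y f y) ^+ 2)%:E <=
   (4 * B)%:E * \int[mu]_x `|(\int[k x]_y u y - \int[mu]_y u y)%:E| +
   8%:E * \int[mu]_x (g x ^+ 2)%:E)%E.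
Proof.
move=> kmu meas_u uB mg ig2 fE.
have {fE}-> : f = (fun x => c + u x + g x) by apply/funext.
have B0 : 0 <= B by exact: le_trans (normr_ge0 _) (uB point).
have mu1 : mu [set: T] = 1%E := probability_setT mu.
have k1 x : k x [set: T] = 1%E := prob_kernel x.
have iu (nu : {measure set T -> \bar R}) : nu [set: T] = 1%E ->
    nu.-integrable [set: T] (EFin \o u).
  by move=> nu1; exact: (integrable_mass1_bounded nu1 meas_u uB).
have Ru (nu : {measure set T -> \bar R}) : nu [set: T] = 1%E ->
    `|\int[nu]_x u x| <= B.
  move=> nu1; apply: le_trans (le_normr_Rintegral measurableT (iu _ nu1)) _.
  rewrite -(Rintegral_mass1_cst nu1 B); apply: le_Rintegral => //.
    exact: (integrable_abse (iu _ nu1)).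
  exact: integrable_mass1_cst.
have Rf (nu : {measure set T -> \bar R}) : nu [set: T] = 1%E ->
    nu.-integrable [set: T] (fun x => (g x ^+ 2)%:E) ->
    \int[nu]_x (c + u x + g x) = c + \int[nu]_x u x + \int[nu]_x g x.
  move=> nu1 inu; have ing := integrable_of_sqr nu1 mg inu.
  have ic := integrable_mass1_cst nu1 c.
  have icu : nu.-integrable [set: T] (EFin \o (fun x => c + u x)).
    exact: (integrableD measurableT ic (iu _ nu1)).
  rewrite (RintegralD measurableT icu ing).
  by rewrite (RintegralD measurableT ic (iu _ nu1)) Rintegral_mass1_cst.
set Q := \int[mu]_x (g x ^+ 2).
have QE : (\int[mu]_x (g x ^+ 2)%:E = Q%:E)%E.
  by rewrite /Q /Rintegral fineK//; exact: integrable_fin_num.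
have Q0 : 0 <= Q by apply: Rintegral_ge0 => x _; exact: sqr_ge0.
have mf : measurable_fun [set: T] (fun x => c + u x + g x).
  by do 2 apply: measurable_funD => //.
have mg2 : measurable_fun [set: T] (fun x => (g x ^+ 2)%:E).
  exact: measurable_int ig2.
have mD v : measurable_fun [set: T] v ->
    measurable_fun [set: T] (fun x => \int[k x]_y v y - \int[mu]_y v y).
  by move=> mv; apply: measurable_funB => //; exact: measurable_Rintegral_kernel.
have mDu : measurable_fun [set: T]
    (fun x => `|(\int[k x]_y u y - \int[mu]_y u y)%:E|%E).
  by apply: measurableT_comp => //; apply/measurable_EFinP; exact: mD.
have mkg : measurable_fun [set: T] (fun x => \int[k x]_y (g y ^+ 2)%:E)%E.
  apply: measurable_fun_integral_kernel => //; first exact: measurable_kernel.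
  by move=> y; rewrite lee_fin sqr_ge0.
(* Pointwise majorant: by invariance its second term integrates to [4 * Q], which together with the
   constant [4 * Q] makes the factor 8. *)
pose rhs x := ((4 * B)%:E * `|(\int[k x]_y u y - \int[mu]_y u y)%:E| +
   (4%:E * (\int[k x]_y (g y ^+ 2)%:E) + (4 * Q)%:E))%E.
have kg0 x : (0 <= \int[k x]_y (g y ^+ 2)%:E)%E.
  by apply: integral_ge0 => y _; rewrite lee_fin sqr_ge0.
have mrhs : measurable_fun [set: T] rhs.
  apply: emeasurable_funD; first exact: measurable_funeM.
  by apply: emeasurable_funD => //; exact: measurable_funeM.
have -> : ((4 * B)%:E * \int[mu]_x `|(\int[k x]_y u y - \int[mu]_y u y)%:E| +
   8%:E * \int[mu]_x (g x ^+ 2)%:E = \int[mu]_x rhs x)%E.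
  rewrite ge0_integralD//; last 4 first.
  - by move=> x _; rewrite mule_ge0// lee_fin mulr_ge0.
  - exact: measurable_funeM.
  - by move=> x _; rewrite adde_ge0 ?mule_ge0// lee_fin mulr_ge0.
  - by apply: emeasurable_funD => //; exact: measurable_funeM.
  rewrite ge0_integralD//; last 3 first.
  - by move=> x _; rewrite mule_ge0.
  - exact: measurable_funeM.
  - by move=> x _; rewrite lee_fin mulr_ge0.
  rewrite ge0_integralZl ?lee_fin ?mulr_ge0//.
  rewrite ge0_integralZl// integral_invariant_kernel//; last first.
    by move=> y; rewrite lee_fin sqr_ge0.
  rewrite (integral_cst mu measurableT) [X in ((4 * Q)%:E * X)%E]probability_setT.
  rewrite mule1 QE.
  by congr (_ + _)%E; rewrite -!EFinM -EFinD; congr EFin; ring.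
apply: ae_ge0_le_integral => //.
- by move=> x _; rewrite lee_fin sqr_ge0.
- by apply/measurable_EFinP; apply: measurable_funX; exact: mD.
- by move=> x _; rewrite !adde_ge0 ?mule_ge0// lee_fin mulr_ge0.
(* The pointwise bound uses integrability of [g ^+ 2] under [k x], available only for almost every
   [x]. *)
have := @integrable_invariant_kernel_ae (fun x => g x ^+ 2) kmu ig2.
apply: filterS => x ikx _; rewrite /rhs.
have kgE : (\int[k x]_y (g y ^+ 2)%:E = (\int[k x]_y (g y ^+ 2))%:E)%E.
  by rewrite /Rintegral fineK//; exact: integrable_fin_num.
rewrite kgE -!EFinM -!EFinD lee_fin (Rf _ (k1 x) ikx) (Rf _ mu1 ig2).
have := sqr_Rintegral_le (k1 x) mg ikx; have := sqr_Rintegral_le mu1 mg ig2.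
rewrite -/Q; have := Ru _ (k1 x); have := Ru _ mu1.
set a := Rintegral (k x) _ u; set b := Rintegral mu _ u.
set a' := Rintegral (k x) _ g; set b' := Rintegral mu _ g.
move: (Rintegral _ _ _) => Q' bB aB hb ha.
have abB : `|a - b| <= 2 * B.
  by apply: le_trans (ler_normB _ _) _; rewrite mulr2n mulrDl mul1r lerD.
have : (a - b) ^+ 2 <= 2 * B * `|a - b|.
  by rewrite -real_normK ?num_real// expr2 ler_wpM2r.
(* The first square bounds [(a - b + (a' - b')) ^+ 2] by [2 * (a - b) ^+ 2 + 2 * (a' - b') ^+ 2];
   the second bounds [(a' - b') ^+ 2] by [2 * a' ^+ 2 + 2 * b' ^+ 2]. *)
have := sqr_ge0 (a - b - (a' - b')); have := sqr_ge0 (a' + b').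
nra.
Qed.

End InvariantKernel.

(** * Truncation of real numbers *)

Section Clip.
Context (R : realType).
Implicit Types B a b : R.

Definition clip B a := Num.max (- B) (Num.min B a).

Lemma norm_clip_le B a : 0 <= B -> `|clip B a| <= B.
Proof.
move=> B0; rewrite ler_norml /clip /Num.max /Num.min.
by case: (ltP B a) => ?; case: ltP => ?; lra.
Qed.

Lemma clip_id B a : `|a| <= B -> clip B a = a.
Proof.
by rewrite ler_norml => /andP[? ?]; rewrite /clip min_r// max_r.
Qed.

Lemma dist_clip_le B a b : `|clip B a - clip B b| <= `|a - b|.
Proof.
have := ler_norm (a - b); have := ler_norm (b - a).
rewrite (distrC b) ler_norml /clip /Num.max /Num.min.
by case: (ltP B a) => ?; case: (ltP B b) => ?; case: ltP => ?; case: ltP => ?;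
  lra.
Qed.

(** The truncated value lies between 0 and [a]. *)
Lemma norm_sub_clip_le B a : 0 <= B -> `|a - clip B a| <= `|a|.
Proof.
move=> B0; have := ler_norm a; have := ler_norm (- a).
rewrite normrN ler_norml /clip /Num.max /Num.min.
by case: (ltP B a) => ?; case: ltP => ?; lra.
Qed.

End Clip.

(** * Lipschitz functions: seminorm bounds and Borel measurability *)

Section Lipschitz.
Context (R : realType) (X : pmetricType R).
Implicit Types f : X -> R.

(** A Lipschitz constant bounds the difference quotients, so their [sup] is a genuine upper bound;
    the case [x = y], absent from the quotients, is immediate. *)
Lemma lip_seminormP f : is_lipschitz f ->
  forall x y, `|f y - f x| <= lip_seminorm f * mdist x y.
Proof.
move=> [K fK] x y; have [->|/eqP xy] := eqVneq x y.
  by rewrite subrr normr0 mdistxx mulr0.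
have d0 : 0 < mdist x y by rewrite mdist_gt0; exact/eqP.
rewrite -ler_pdivrMr//; apply: ub_le_sup; last by exists (x, y).
exists K => _ [[x' y'] /= xy' <-]; rewrite ler_pdivrMr//.
by rewrite mdist_gt0; exact/eqP.
Qed.

(** Difference quotients are nonnegative, and [sup] is 0 by default on a set that is empty or
    unbounded above. *)
Lemma lip_seminorm_ge0 f : 0 <= lip_seminorm f.
Proof.
rewrite /lip_seminorm; set S := image _ _.
have [S_sup|/sup_out->//] := pselect (has_sup S).
have [_ [xy xyN _]] := S_sup.1.
apply: le_trans; last by apply: (sup_upper_bound S_sup); exists xy.
by rewrite divr_ge0// mdist_ge0.
Qed.

(** The condition [0 <= K] covers a one-point space, where the seminorm is [sup set0 = 0]. *)
Lemma lip_seminorm_le f (K : R) : 0 <= K ->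
  (forall x y, `|f y - f x| <= K * mdist x y) -> lip_seminorm f <= K.
Proof.
move=> K0 fK; rewrite /lip_seminorm; set S := image _ _.
have [[S0 _]|/sup_out->//] := pselect (has_sup S).
apply: ge_sup => // _ [[x' y'] /= xy' <-]; rewrite ler_pdivrMr//.
by rewrite mdist_gt0; exact/eqP.
Qed.

Lemma sup_norm_le f (B : R) : (forall x, `|f x| <= B) -> sup_norm f <= B.
Proof.
move=> fB; apply: ge_sup; first by exists `|f point|, point.
by move=> _ [x _ <-].
Qed.

Lemma sup_norm_ge0 f : 0 <= sup_norm f.
Proof.
rewrite /sup_norm; set S := image _ _.
have [S_sup|/sup_out->//] := pselect (has_sup S).
by apply: le_trans; last by apply: (sup_upper_bound S_sup); exists point.
Qed.

Lemma lipschitz_continuous f : is_lipschitz f -> continuous f.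
Proof.
move=> fl x; apply/cvgrPdist_lt => e e0; apply/nbhs_ballP.
have L0 := lip_seminorm_ge0 f.
have L1 : 0 < lip_seminorm f + 1 by rewrite ltr_pwDr.
exists (e / (lip_seminorm f + 1)); first by rewrite /= divr_gt0.
(* The added 1 keeps the radius well defined when the seminorm is 0. *)
move=> y; rewrite ballEmdist/= ltr_pdivlMr// distrC => xy.
apply: le_lt_trans (lip_seminormP fl x y) _; apply: le_lt_trans xy.
by rewrite mulrC ler_wpM2l ?mdist_ge0// lerDl.
Qed.

(** Continuity pulls open intervals, which generate the Borel sets of the line, back to open
    sets. *)
Lemma lipschitz_measurable f : is_lipschitz f ->
  measurable_fun [set: borel X] (f : borel X -> R).
Proof.
move=> /lipschitz_continuous/continuousP cf.
apply: (measurability _ (RGenOpens.measurableE R)).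
move=> _ [_ [a [b ->] <-]]; rewrite setTI; apply: sub_sigma_algebra.
exact/cf/interval_open.
Qed.

Lemma lipschitz_mdist (x0 : X) : is_lipschitz (mdist ^~ x0).
Proof.
exists 1 => x y; rewrite mul1r ler_norml; apply/andP; split.
  by rewrite lerNl opprB lerBlDr metric_triangle.
by rewrite lerBlDr (metric_sym x y) metric_triangle.
Qed.

End Lipschitz.

(** * Truncation estimate for the L2 deviation of a Lipschitz function *)

Section LipschitzDeviation.
Context (R : realType) (X : pmetricType R) (Pi : probability (borel X) R)
  (k : R.-pker (borel X) ~> (borel X)).

Lemma measurable_deviation (f : X -> R) : is_lipschitz f ->
  measurable_fun [set: borel X]
    (fun x : borel X => kernel_act k f x - \int[Pi]_y f y).
Proof.
move=> /lipschitz_measurable mf; apply: measurable_funB => //.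
exact: measurable_Rintegral_kernel.
Qed.

Lemma sqr_tail_le (p L M d h : R) : 1 < p -> 0 <= L -> 1 <= M -> 0 <= d ->
  `|h| <= L * d ->
  (h - clip (L * M) h) ^+ 2 <= L ^+ 2 / M `^ (2 * p - 2) * d `^ (2 * p).
Proof.
move=> p1 L0 M1 d0 hd.
have M0 : 0 < M by exact: lt_le_trans M1.
have Mp0 : 0 < M `^ (2 * p - 2) by exact: powR_gt0.
have LM0 : 0 <= L * M by rewrite mulr_ge0// ltW.
have [dM|Md] := leP d M.
  rewrite clip_id ?subrr ?expr0n/=; last first.
    by apply: le_trans hd _; rewrite ler_wpM2l.
  by rewrite mulr_ge0 ?powR_ge0// divr_ge0 ?sqr_ge0// ltW.
have {}d0 : 0 < d by exact: lt_trans Md.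
have -> : d `^ (2 * p) = d ^+ 2 * d `^ (2 * p - 2).
  rewrite -powR_mulrn ?(ltW d0)// -powRD; last by rewrite (gt_eqF d0)/= implybT.
  by congr (_ `^ _); ring.
have -> : L ^+ 2 / M `^ (2 * p - 2) * (d ^+ 2 * d `^ (2 * p - 2)) =
  (L * d) ^+ 2 * (d `^ (2 * p - 2) / M `^ (2 * p - 2)) by ring.
apply: (@le_trans _ _ ((L * d) ^+ 2)).
  rewrite -real_normK ?num_real// ler_pXn2r ?nnegrE ?mulr_ge0 ?(ltW d0)//.
  exact: le_trans (norm_sub_clip_le _ LM0) hd.
rewrite ler_peMr ?sqr_ge0// ler_pdivlMr// mul1r.
by apply: ge0_ler_powR; rewrite ?nnegrE ?ltW//; lra.
Qed.

(* [M] is the truncation level; [e] plays the role of [C1 * R t ^ kappa1]. *)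
Lemma L2_deviation_le (p M e D : R) (x0 : X) (f : X -> R) :
  (forall A, measurable A -> (\int[Pi]_x k x A = Pi A)%E) ->
  1 < p -> 1 <= M -> 0 <= e ->
  (\int[Pi]_x (mdist (x : X) x0 `^ (2 * p))%:E = D%:E)%E ->
  (forall u : X -> R, [bounded u x | x in [set: X]] -> is_lipschitz u ->
     ('N[Pi]_1 [(fun x => (kernel_act k u x - \int[Pi]_y u y)%:E)]
      <= (e * (sup_norm u + lip_seminorm u))%:E)%E) ->
  is_lipschitz f ->
  ('N[Pi]_2 [(fun x => (kernel_act k f x - \int[Pi]_y f y)%:E)] ^+ 2
   <= (8 * (e * M ^+ 2 + D / M `^ (2 * p - 2)) * lip_seminorm f ^+ 2)%:E)%E.
Proof.
move=> kPi p1 M1 e0 DE dev_le fl.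
have M0 : 0 < M by exact: lt_le_trans M1.
set L := lip_seminorm f; have L0 : 0 <= L by exact: lip_seminorm_ge0.
have B0 : 0 <= L * M by rewrite mulr_ge0// ltW.
pose u x := clip (L * M) (f x - f x0).
pose g x := f x - f x0 - u x.
have uL x y : `|u y - u x| <= L * mdist x y.
  apply: le_trans (dist_clip_le _ _ _) _.
  by rewrite opprB addrA subrK; exact: lip_seminormP.
have ul : is_lipschitz u by exists L.
have uB x : `|u x| <= L * M by exact: norm_clip_le.
have meas_u := lipschitz_measurable ul.
have mg : measurable_fun [set: borel X] (g : borel X -> R).
  apply: measurable_funB => //; apply: measurable_funB => //.
  exact: lipschitz_measurable.
pose dp (x : borel X) := mdist (x : X) x0 `^ (2 * p).
have mdp : measurable_fun [set: borel X] dp.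
  apply: (measurableT_comp (measurable_powR (2 * p))).
  exact: (lipschitz_measurable (lipschitz_mdist x0)).
pose q := L ^+ 2 / M `^ (2 * p - 2).
have q0 : 0 <= q by rewrite divr_ge0 ?sqr_ge0// powR_ge0.
have g2 (x : borel X) : g x ^+ 2 <= q * dp x.
  apply: sqr_tail_le => //; first exact: mdist_ge0.
  by rewrite metric_sym; exact: lip_seminormP.
have idp : Pi.-integrable [set: borel X] (EFin \o dp).
  apply/integrableP; split; first exact/measurable_EFinP.
  under eq_integral do rewrite gee0_abs ?lee_fin ?powR_ge0//.
  by rewrite DE ltry.
have mg2 : measurable_fun [set: borel X] (fun x : borel X => (g x ^+ 2)%:E).
  by apply/measurable_EFinP; exact: measurable_funX.
have ig2 : Pi.-integrable [set: borel X] (fun x : borel X => (g x ^+ 2)%:E).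
  apply: (le_integrable measurableT mg2 _ (integrableZl measurableT q idp)).
  move=> x _; rewrite /= lee_fin ger0_norm ?sqr_ge0// ger0_norm ?g2//.
  by rewrite mulr_ge0// powR_ge0.
have Ig2 : (\int[Pi]_x (g x ^+ 2)%:E <= (q * D)%:E)%E.
  rewrite EFinM -DE -ge0_integralZl_EFin//; last 2 first.
    by move=> x _; rewrite lee_fin powR_ge0.
    exact/measurable_EFinP.
  apply: ge0_le_integral => //.
  - by move=> x _; rewrite lee_fin sqr_ge0.
  - by apply: measurable_funeM; exact/measurable_EFinP.
  - by move=> x _; rewrite -EFinM lee_fin g2.
have bu : [bounded u x | x in [set: X]].
  exists (L * M); split; first exact: num_real.
  by move=> N BN x _ /=; rewrite (le_trans (uB x))// ltW.
have := dev_le u bu ul; rewrite Lnorm1 => Du.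
have fE (x : borel X) : f x = f x0 + u x + g x by rewrite /g; ring.
rewrite [leLHS]sqr_Lnorm2.
apply: le_trans (@L2_deviation_split _ (borel X) R Pi k (f x0) (L * M) f u g
  kPi meas_u uB mg ig2 fE) _.
(* The L1 hypothesis is applied to [u], with sup norm at most [L * M] and Lipschitz seminorm at most
   [L]. *)
apply: (@le_trans _ _ ((4 * (L * M))%:E * (e * (L * M + L))%:E +
    8%:E * (q * D)%:E)%E).
  apply: leeD; last by rewrite lee_wpmul2l.
  apply: lee_wpmul2l; first by rewrite lee_fin mulr_ge0.
  apply: (le_trans Du).
  rewrite lee_fin ler_wpM2l// lerD//; first exact: sup_norm_le.
  exact: lip_seminorm_le.
rewrite -!EFinM -EFinD lee_fin /q.
have -> : 8 * (e * M ^+ 2 + D / M `^ (2 * p - 2)) * L ^+ 2 =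
  8 * e * L ^+ 2 * M ^+ 2 + 8 * (L ^+ 2 / M `^ (2 * p - 2) * D) by ring.
rewrite lerD2r.
have -> : 4 * (L * M) * (e * (L * M + L)) = 4 * e * L ^+ 2 * (M ^+ 2 + M) by ring.
have -> : 8 * e * L ^+ 2 * M ^+ 2 = 4 * e * L ^+ 2 * (M ^+ 2 + M ^+ 2) by ring.
(* [M <= M ^+ 2] because [1 <= M]. *)
by rewrite ler_wpM2l ?mulr_ge0 ?sqr_ge0// lerD2l ler_eXnr.
Qed.

End LipschitzDeviation.

(** * Equivalence of the L1 and L2 rates *)

Theorem proposition5 (R : realType) (X : pmetricType R) (T : set R)
    (P : R -> R.-pker (borel X) ~> (borel X)) (Pi : probability (borel X) R)
    (rate : R -> R) :
  time_set T ->
  markov_semigroup T P ->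
  unique_invariant T P Pi ->
  (exists (p : R) (x0 : X), 1 < p /\
     (\int[Pi]_x ((mdist (x : X) x0) `^ (2 * p))%:E < +oo)%E) ->
  rate_function T rate ->
  (exists C1 kappa1 : R, [/\ 0 < C1, 0 < kappa1 <= 1 &
     forall t : R, T t ->
     forall f : X -> R, [bounded f x | x in [set: X]] -> is_lipschitz f ->
       ('N[Pi]_1 [(fun x => (kernel_act (P t) f x - \int[Pi]_y f y)%:E)]
        <= (C1 * rate t `^ kappa1 * (sup_norm f + lip_seminorm f))%:E)%E])
  <->
  (exists C2 kappa2 : R, [/\ 0 < C2, 0 < kappa2 <= 1 &
     forall t : R, T t ->
     forall f : X -> R, is_lipschitz f ->
       ('N[Pi]_2 [(fun x => (kernel_act (P t) f x - \int[Pi]_y f y)%:E)] ^+ 2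
        <= (C2 * rate t `^ kappa2 * lip_seminorm f ^+ 2)%:E)%E]).
Proof.
move=> _ _ [inv _] [p [x0 [p1 dfin]]] [rate01 _ _].
have p0 : 0 < p by exact: lt_trans p1.
split=> [[C1 [k1 [C10 /andP[k10 k11] dev]]]|[C2 [k2 [C20 /andP[k20 k21] dev]]]].
  have d0 : (0 <= \int[Pi]_x ((mdist (x : X) x0) `^ (2 * p))%:E)%E.
    by apply: integral_ge0 => x _; rewrite lee_fin powR_ge0.
  set D := fine (\int[Pi]_x ((mdist (x : X) x0) `^ (2 * p))%:E)%E.
  have DE : (\int[Pi]_x ((mdist (x : X) x0) `^ (2 * p))%:E = D%:E)%E.
    by rewrite /D fineK// ge0_fin_numE.
  have D0 : 0 <= D by rewrite fine_ge0.
  (* With the chosen [M], the two terms of the truncation estimate become [C1] and [D] times the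
     same power of the rate. *)
  exists (8 * (C1 + D)), (k1 * (1 - p^-1)); split.
  - by rewrite mulr_gt0// ltr_wpDr.
  - have ? : p^-1 < 1 by rewrite invf_lt1.
    have ? : 0 < p^-1 by rewrite invr_gt0.
    apply/andP; split; nra.
  - move=> t Tt f fl; have /andP[r0 r1] := rate01 t Tt.
    set r := rate t in r0 r1 *.
    pose M := r `^ (- (k1 / (2 * p))).
    (* A nonpositive power of [r], which lies in [(0, 1]], is at least 1. *)
    have M1 : 1 <= M.
      rewrite -[leLHS](powRr0 r) ger_powR ?r0//.
      by rewrite oppr_le0 divr_ge0 ?mulr_ge0// ltW.
    have e0 : 0 <= C1 * r `^ k1 by rewrite mulr_ge0 ?powR_ge0// ltW.
    have M2 : r `^ k1 * M ^+ 2 = r `^ (k1 * (1 - p^-1)).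
      rewrite -powR_mulrn ?powR_ge0// -powRrM -powRD ?(gt_eqF r0)/= ?implybT//.
      by congr (_ `^ _); field; rewrite gt_eqF.
    (* The exponent is [k1 * (2 * p - 2) / (2 * p)], equal to the exponent [k1 - k1 / p] found in
       [M2]. *)
    have Mp : (M `^ (2 * p - 2))^-1 = r `^ (k1 * (1 - p^-1)).
      rewrite -powRN -powRrM.
      by congr (_ `^ _); field; rewrite gt_eqF.
    apply: le_trans (L2_deviation_le (inv t Tt) p1 M1 e0 DE (dev t Tt) fl) _.
    by rewrite -(mulrA C1) M2 Mp lee_fin le_eqVlt; apply/orP; left; apply/eqP; ring.
exists (Num.sqrt C2), (k2 / 2); split.
- by rewrite sqrtr_gt0.
- by apply/andP; split; lra.
- move=> t Tt f _ fl; have /andP[r0 _] := rate01 t Tt.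
  apply: le_trans (Lnorm1_le_sqrt (probability_setT Pi)
    (measurable_deviation _ _ fl) (dev t Tt f fl)) _.
  rewrite lee_fin sqrtrM ?mulr_ge0 ?powR_ge0 ?(ltW C20)// sqrtrM ?(ltW C20)//.
  rewrite sqrtr_sqr ger0_norm ?lip_seminorm_ge0// -(powR12_sqrt (powR_ge0 _ k2)).
  by rewrite -powRrM ler_wpM2l ?lerDr ?sup_norm_ge0// mulr_ge0 ?powR_ge0 ?sqrtr_ge0.
Qed.
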